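(* Let $l\ge 1$, let $p_1>p_2>\cdots>p_l\ge 1$ be integers, and let $s_1,\ldots,s_l$ be integers with $s_i\ge 3$ for every $i=1,\ldots,l$. Then the complete multipartite graph with $s_1$ parts of size $p_1$, $s_2$ parts of size $p_2$, $\ldots$, $s_l$ parts of size $p_l$, i.e. $K_{p_1,\ldots,p_1,\ldots,p_l,\ldots,p_l}$ (with $p_i$ repeated $s_i$ times), is $S$-determined.
   Context: All graphs are finite and simple. For a graph $G$, the Seidel matrix is $S(G)=J-I-2A(G)$, where $A(G)$ is the adjacency matrix, $J$ the all-ones matrix and $I$ the identity; its eigenvalue multiset is the Seidel spectrum of $G$. For a partition $V(G)=U\cup W$, Seidel switching with respect to $U$ deletes all edges between $U$ and $W$ and adds an edge between $u\in U$, $w\in W$ whenever $uw$ was not an edge. Two graphs are switching equivalent if one is obtained from the other by a Seidel switching. A graph $G$ is $S$-determined if every graph with the same Seidel spectrum as $G$ is switching equivalent to a graph isomorphic to $G$. *)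

(* Defs.v *)
From HB Require Import structures.
From mathcomp Require Import all_boot all_order all_algebra all_field.

Set Implicit Arguments.
Unset Strict Implicit.
Unset Printing Implicit Defensive.

Import GRing.Theory.
Local Open Scope ring_scope.

Record sgraph (V : finType) := SGraph {
  adj : rel V;
  adj_sym : symmetric adj;
  adj_irrefl : irreflexive adj
}.

(* Rows and columns are indexed by the vertices through enum_val. *)
Definition adjacency_mx (V : finType) (G : sgraph V) : 'M[algC]_#|V| :=
  \matrix_(i, j) (adj G (enum_val i) (enum_val j))%:R.

Definition seidel_mx (V : finType) (G : sgraph V) : 'M[algC]_#|V| :=
  const_mx 1 - 1%:M - 2%:R *: adjacency_mx G.

(* The roots, listed with multiplicity, of the (monic) characteristic         *)
(* polynomial. The order of the list is irrelevant: as a multiset it is to be *)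
(* compared up to perm_eq.                                                    *)
Definition spectrum (n : nat) (M : 'M[algC]_n) : seq algC :=
  sval (closed_field_poly_normal (char_poly M)).

Definition seidel_spectrum (V : finType) (G : sgraph V) : seq algC :=
  spectrum (seidel_mx G).

Definition switch_adj (V : finType) (G : sgraph V) (U : {set V}) : rel V :=
  fun x y => if (x \in U) == (y \in U) then adj G x y else ~~ adj G x y.

Lemma switch_adj_sym (V : finType) (G : sgraph V) (U : {set V}) :
  symmetric (switch_adj G U).
Proof. by move=> x y; rewrite /switch_adj eq_sym adj_sym. Qed.

Lemma switch_adj_irrefl (V : finType) (G : sgraph V) (U : {set V}) :
  irreflexive (switch_adj G U).
Proof. by move=> x; rewrite /switch_adj eqxx adj_irrefl. Qed.

(* The partition is U together with its complement; either may be empty. *)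
Definition switch (V : finType) (G : sgraph V) (U : {set V}) : sgraph V :=
  SGraph (switch_adj_sym G U) (switch_adj_irrefl G U).

Definition switching_equivalent (V : finType) (G H : sgraph V) : Prop :=
  exists U : {set V}, adj H =2 adj (switch G U).

Definition isomorphic (V W : finType) (G : sgraph V) (H : sgraph W) : Prop :=
  exists2 f : V -> W, bijective f & forall x y, adj H (f x) (f y) = adj G x y.

Definition S_determined (V : finType) (G : sgraph V) : Prop :=
  forall (W : finType) (H : sgraph W),
    perm_eq (seidel_spectrum H) (seidel_spectrum G) ->
    exists2 G' : sgraph W, switching_equivalent H G' & isomorphic G' G.

Definition multipartite_adj (I : finType) (n : I -> nat) :
    rel {i : I & 'I_(n i)} :=
  fun x y => tag x != tag y.

Lemma multipartite_adj_sym (I : finType) (n : I -> nat) :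
  symmetric (@multipartite_adj I n).
Proof. by move=> x y; rewrite /multipartite_adj eq_sym. Qed.

Lemma multipartite_adj_irrefl (I : finType) (n : I -> nat) :
  irreflexive (@multipartite_adj I n).
Proof. by move=> x; rewrite /multipartite_adj eqxx. Qed.

(* The parts are indexed by I, part i has n i vertices. *)
Definition complete_multipartite (I : finType) (n : I -> nat) :
    sgraph {i : I & 'I_(n i)} :=
  SGraph (@multipartite_adj_sym I n) (@multipartite_adj_irrefl I n).

(* Part (i, j), with j < s i, has size p i. *)
Definition complete_multipartite_rep (l : nat) (p s : 'I_l -> nat) :
    sgraph {k : {i : 'I_l & 'I_(s i)} & 'I_(p (tag k))} :=
  complete_multipartite (fun k : {i : 'I_l & 'I_(s i)} => p (tag k)).

(* Main.v *)
Require Import Defs.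
From HB Require Import structures.
From mathcomp Require Import all_boot all_order all_algebra all_field.
From mathcomp Require Import spectral sesquilinear ring.

Set Implicit Arguments.
Unset Strict Implicit.
Unset Printing Implicit Defensive.

Import Order.TTheory GRing.Theory Num.Theory.
Local Open Scope ring_scope.
Local Open Scope sesquilinear_scope.

(** For a complete multipartite graph, S + I is twice a positive semidefinite
    matrix minus J, so at most one eigenvalue of S is < -1. Conversely, suppose
    that at most one Seidel eigenvalue of H is < -1. Switch H so that a vertex v
    becomes isolated; then no edge xy and non-isolated vertex z adjacent to
    neither x nor y exist (forbidden 2K_2, P_4 and paw), so switching the set of
    isolated vertices yields a complete multipartite graph.

    If a complete multipartite graph on n vertices has part sizes p_i, padded
    with zeros to n entries, and P = \prod_i (X - 2 p_i), then its
    Seidel characteristic polynomial chi satisfies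
    2 chi(y - 1) = y P'(y) - (n - 2) P(y). Hence two such graphs with equal chi
    have P - Q = c X^(n-2). If a > 0 is a triple root of P then it is a root of
    Q, since otherwise y Q'/Q - (n - 2) would have a double zero at a, whereas
    its derivative is negative there. So c = 0 and the part sizes agree. *)

(** * Hermitian matrices with at most one eigenvalue below -1 *)

Lemma char_poly_conjugate (R : comNzRingType) n (A P Q : 'M[R]_n) :
  Q *m P = 1%:M -> char_poly (P *m A *m Q) = char_poly A.
Proof.
move=> QP; rewrite /char_poly /char_poly_mx.
have -> : 'X%:M - map_mx polyC (P *m A *m Q) =
    map_mx polyC P *m ('X%:M - map_mx polyC A) *m map_mx polyC Q.
  rewrite mulmxBr mulmxBl -!map_mxM mul_mx_scalar -scalemxAl -map_mxM.
  by rewrite (mulmx1C QP) map_mx1 scalemx1.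
rewrite !det_mulmx mulrAC -det_mulmx -map_mxM (mulmx1C QP) map_mx1 det1.
exact: mul1r.
Qed.

Lemma char_poly_spectrum n (A : 'M[algC]_n) :
  char_poly A = \prod_(z <- spectrum A) ('X - z%:P).
Proof.
rewrite /spectrum; case: closed_field_poly_normal => r /= {1}->.
by rewrite (monicP (char_poly_monic A)) scale1r.
Qed.

Lemma hermitian_diagonalization n (A : 'M[algC]_n) : A \is hermsymmx ->
  exists P : 'M[algC]_n, exists d : 'rV[algC]_n,
    [/\ P *m P^t* = 1%:M, forall i, d 0 i \is Num.real,
        perm_eq (spectrum A) [seq d 0 i | i <- enum 'I_n] &
        A = P^t* *m diag_mx d *m P].
Proof.
move=> hA; have /orthomx_spectralP := hermitian_normalmx hA.
rewrite invmx_unitary ?spectral_unitarymx //.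
set P := spectralmx A; set d := spectral_diag A => AE.
have PP : P *m P^t* = 1%:M by apply/unitarymxP/spectral_unitarymx.
exists P, d; split => //.
  by move=> i; move/mxOverP: (hermitian_spectral_diag_real hA).
apply: prod_XsubC_eq; rewrite -char_poly_spectrum AE char_poly_conjugate //.
rewrite char_poly_trig ?diag_mx_is_trig // big_map enumT.
by apply: eq_bigr => i _; rewrite !mxE eqxx mulr1n.
Qed.

Lemma hermitian_form_diag n (P : 'M[algC]_n) (d z : 'rV[algC]_n) :
  P *m P^t* = 1%:M ->
  ((z *m P) *m (P^t* *m diag_mx d *m P) *m (z *m P)^t*) 0 0 =
    \sum_i d 0 i * `|z 0 i| ^+ 2.
Proof.
move=> PP; rewrite trmx_mul map_mxM -!mulmxA (mulmxA P (P^t* )) PP mul1mx.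
rewrite (mulmxA P (P^t* )) PP mul1mx mulmxA mxE; apply: eq_bigr => i _.
by rewrite mul_mx_diag !mxE normCK mulrAC mulrC.
Qed.

(** If two eigenvalues lie below -1, their eigenvectors span a plane on which the form of [A + 1%:M]
    is negative, and [w *m u = 0] has a nonzero solution there. If there is only one, its
    eigenvector serves as [u]. *)
Lemma count_spectrum_lt_le1P n (A : 'M[algC]_n) : A \is hermsymmx ->
  (count (fun z : algC => z < -1)%R (spectrum A) <= 1)%N <->
  exists u : 'cV[algC]_n, forall w : 'rV_n,
    w *m u = 0 -> 0 <= (w *m (A + 1%:M) *m w^t*) 0 0.
Proof.
case/hermitian_diagonalization=> P [d] [PP dr /permP-> AE].
have PP' := mulmx1C PP.
have formE (z : 'rV[algC]_n) : ((z *m P) *m (A + 1%:M) *m (z *m P)^t*) 0 0 =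
    \sum_i (d 0 i + 1) * `|z 0 i| ^+ 2.
  have -> : A + 1%:M = P^t* *m diag_mx (d + const_mx 1) *m P.
    by rewrite raddfD /= diag_const_mx mulmxDr mulmx1 mulmxDl PP' -AE.
  rewrite hermitian_form_diag //.
  by apply: eq_bigr => i _; rewrite !mxE.
have -> : count (fun z => z < -1) [seq d 0 i | i <- enum 'I_n] =
    #|[pred i | d 0 i < -1]|.
  rewrite count_map cardE enumT /enum_mem size_filter.
  by apply: eq_count => i; rewrite /= inE.
split.
  move=> le1.
  have [i0 i0P] : exists i0 : option 'I_n, forall i, d 0 i < -1 -> Some i = i0.
    case: (pickP [pred i | d 0 i < -1]) => [i0 /= di0|no]; last first.
      by exists None => i /= di; have := no i; rewrite /= di.
    exists (Some i0) => i di; congr Some.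
    by apply: (card_le1_eqP le1); rewrite inE.
  (* Column [i] of [P^t*] is an eigenvector for [d 0 i], so [w *m u = 0] removes the only negative
     term of the form. With no eigenvalue below -1, [u = 0] imposes no condition. *)
  exists (if i0 is Some i then col i (P^t* ) else 0) => w wu.
  have -> : w = (w *m P^t*) *m P by rewrite -mulmxA PP' mulmx1.
  rewrite formE sumr_ge0 // => i _.
  have [di|] := boolP (d 0 i < -1); last first.
    rewrite -real_leNgt ?rpredN ?rpred1 // => di.
    by rewrite mulr_ge0 ?exprn_ge0 // -lerBlDr sub0r.
  move: wu; rewrite -(i0P i di) colE mulmxA -colE => /matrixP/(_ 0 0).
  by rewrite !mxE => ->; rewrite normr0 expr0n mulr0.
case=> u uP; rewrite leqNgt; apply/negP=> /card_gt1P[i [j [/= di dj ij]]].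
rewrite !inE in di dj.
pose a := (P *m u) i 0; pose b := (P *m u) j 0.
(* Coefficients of a nonzero combination of eigenvectors [i] and [j] annihilated by [u]. *)
have [x [y [xy0 nz]]] : exists x, exists y, x * a + y * b = 0 /\ (x != 0) || (y != 0).
  have [a0|a0] := eqVneq a 0; first by exists 1, 0; rewrite a0 mulr0 mul0r addr0 oner_eq0.
  by exists (- b), a; rewrite mulNr mulrC addNr a0 orbT.
pose z : 'rV[algC]_n := x *: delta_mx 0 i + y *: delta_mx 0 j.
have /uP : (z *m P) *m u = 0.
  rewrite -mulmxA mulmxDl -!scalemxAl -!rowE; apply/matrixP=> k l.
  by rewrite !ord1 !mxE -[RHS]xy0 /a /b !mxE.
rewrite formE (bigD1 i) // (bigD1 j) 1?eq_sym //= big1 => [|k /andP[ki kj]]; last first.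
  by rewrite !mxE !eqxx (negbTE ki) (negbTE kj) /= !mulr0 addr0 normr0 expr0n mulr0.
rewrite !mxE !eqxx /= (negbTE ij) eq_sym (negbTE ij) /= !mulr0 !mulr1 addr0 add0r addr0.
apply/negP; rewrite -real_ltNge //; last first.
- by rewrite !(rpredD, rpredM, rpred1, rpredX) ?dr ?normr_real.
have di' : d 0 i + 1 < 0 by rewrite -ltrBrDr sub0r.
have dj' : d 0 j + 1 < 0 by rewrite -ltrBrDr sub0r.
have ex (t : algC) c : c < 0 -> c * `|t| ^+ 2 <= 0.
  by move=> c0; rewrite mulr_le0_ge0 ?exprn_ge0 // ltW.
have ex' (t : algC) c : t != 0 -> c < 0 -> c * `|t| ^+ 2 < 0.
  by move=> t0 c0; rewrite nmulr_rlt0 // exprn_gt0 // normr_gt0.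
case/orP: nz => nz; first by rewrite ltr_nwDl ?ex' ?ex.
by rewrite ltr_nwDr ?ex' ?ex.
Qed.

(** * Determinant identities and the Seidel characteristic polynomial *)

Lemma det_add1_mulmxC (R : comNzRingType) m n (A : 'M[R]_(m, n)) (B : 'M_(n, m)) :
  \det (1%:M + A *m B) = \det (1%:M + B *m A).
Proof.
(* Sylvester's identity: both sides equal [\det K], computed by eliminating one or the other
   off-diagonal block. *)
pose K := block_mx 1%:M (- A) B 1%:M.
have eL : block_mx 1%:M A 0 1%:M *m K = block_mx (1%:M + A *m B) 0 B 1%:M.
  by rewrite mulmx_block !mul1mx !mul0mx mulmx1 addNr !add0r.
have eR : block_mx 1%:M 0 (- B) 1%:M *m K = block_mx 1%:M (- A) 0 (1%:M + B *m A).
  by rewrite mulmx_block !mul1mx !mul0mx mulmx1 !addr0 addNr mulNmx mulmxN opprK addrC.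
have := congr1 determinant eL; have := congr1 determinant eR.
rewrite !det_mulmx !(det_ublock, det_lblock) !det1 !(mul1r, mulr1).
by move=> -> ->.
Qed.

Lemma det_scalar_sub_mulmxC (F : fieldType) n (y : F) (A B : 'M[F]_n) :
  y != 0 -> \det (y%:M - A *m B) = \det (y%:M - B *m A).
Proof.
move=> y0.
have e (M : 'M[F]_n) : y%:M - M = y *: (1%:M + - y^-1 *: M).
  by rewrite scalerDr scalemx1 scalerA mulrN divff // scaleN1r.
by rewrite !e !detZ scalemxAl det_add1_mulmxC scalemxAr.
Qed.

(** The matrix determinant lemma: after factoring out [diag_mx d], Sylvester's identity leaves a 1 x
    1 determinant. *)
Lemma det_diag_add_rank1 (F : fieldType) n (d v : 'rV[F]_n) :
  (forall i, d 0 i != 0) ->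
  \det (diag_mx d + const_mx 1 *m v) =
    \prod_i d 0 i * (1 + \sum_i v 0 i / d 0 i).
Proof.
move=> d0; pose u : 'cV[F]_n := \col_i (d 0 i)^-1.
have -> : diag_mx d + const_mx 1 *m v = diag_mx d *m (1%:M + u *m v).
  rewrite mulmxDr mulmx1 mulmxA; congr (_ + _ *m _).
  by apply/colP=> i; rewrite mul_diag_mx !mxE divff.
rewrite det_mulmx det_diag det_add1_mulmxC det_mx11 !mxE; congr (_ * (_ + _)).
by apply: eq_bigr => i _; rewrite !mxE.
Qed.

Lemma horner_char_poly (R : comNzRingType) n (A : 'M[R]_n) x :
  (char_poly A).[x] = \det (x%:M - A).
Proof.
rewrite -horner_evalE -det_map_mx; congr (\det _); apply/matrixP=> i j.
by rewrite !mxE /= horner_evalE !hornerE; case: eqP; rewrite ?(mulr1n, mulr0n, hornerE).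
Qed.

(* Parts are indexed by all of V; those outside the image of c are empty. *)
Definition part_size (V : finType) (c : V -> V) (i : V) : nat :=
  #|[set x | c x == i]|.

(** With [B] the vertex-colour incidence matrix, S + I = 2 B B^T - J = B (2 I - J) B^T. Moving [B]
    cyclically inside the determinant produces B^T B, the diagonal matrix of part sizes, and what
    remains is diagonal plus rank one. *)
Lemma seidel_char_poly_colored (V : finType) (G : sgraph V) (c : V -> V) (y : algC) :
  (forall u v, adj G u v = (c u != c v)) ->
  y != 0 -> (forall i, y != 2 * (part_size c i)%:R) ->
  (char_poly (seidel_mx G)).[y - 1] =
    \prod_i (y - 2 * (part_size c i)%:R) *
      (1 + \sum_i (part_size c i)%:R / (y - 2 * (part_size c i)%:R)).
Proof.
move=> cE y0 yp; rewrite horner_char_poly.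
pose B : 'M[algC]_#|V| := \matrix_(i, j) (c (enum_val i) == enum_val j)%:R.
pose N : 'M[algC]_#|V| := 2%:M - const_mx 1.
have -> : (y - 1)%:M - seidel_mx G = y%:M - B *m (N *m B^T).
  have Brow i : \sum_j B i j = 1.
    rewrite (bigD1 (enum_rank (c (enum_val i)))) //= !mxE enum_rankK eqxx.
    rewrite big1 ?addr0 // => j nj; rewrite mxE; case: eqP => // e.
    by rewrite e enum_valK eqxx in nj.
  have JB : const_mx 1 *m B^T = const_mx 1 :> 'M_#|V|.
    apply/matrixP=> i j; rewrite !mxE -[RHS](Brow j).
    by apply: eq_bigr => k _; rewrite !mxE mul1r.
  have BJ : B *m const_mx 1 = const_mx 1 :> 'M_#|V|.
    apply/matrixP=> i j; rewrite !mxE -[RHS](Brow i).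
    by apply: eq_bigr => k _; rewrite !mxE mulr1.
  rewrite mulmxBl mulmxBr JB BJ mul_scalar_mx -scalemxAr.
  have BB : B *m B^T = \matrix_(i, j) (c (enum_val i) == c (enum_val j))%:R.
    apply/matrixP=> i j; rewrite !mxE.
    rewrite (bigD1 (enum_rank (c (enum_val i)))) //= !mxE enum_rankK eqxx mul1r.
    rewrite big1 ?addr0 1?eq_sym // => k nk; rewrite !mxE; case: eqP => e; last by rewrite mul0r.
    by rewrite e enum_valK eqxx in nk.
  rewrite BB; apply/matrixP=> i j; rewrite !mxE cE.
  case: (altP (_ =P c (enum_val j))) => /= _; case: (i == j); rewrite ?(mulr1n, mulr0n, mulr0, mulr1); ring.
rewrite det_scalar_sub_mulmxC // -mulmxA.
have eiE (i j : 'I_#|V|) : (enum_val i == enum_val j) = (i == j).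
  exact: (inj_eq enum_val_inj).
have -> : B^T *m B = diag_mx (\row_i (part_size c (enum_val i))%:R).
  apply/matrixP=> i j; rewrite !mxE.
  have -> : \sum_k B^T i k * B k j = \sum_(k < #|V|) (i == j)%:R * (c (enum_val k) == enum_val j)%:R.
    apply: eq_bigr => k _; rewrite !mxE; case: (altP (c _ =P enum_val j)) => [->|_].
      by rewrite eiE eq_sym.
    by rewrite !mulr0.
  rewrite -mulr_sumr mulrC mulr_natr; case: (altP (i =P j)) => [->|//].
  rewrite !mulr1n /part_size -sum1_card natr_sum [RHS](reindex (fun k : 'I_#|V| => enum_val k)) /=.
    by rewrite [RHS]big_mkcond; apply: eq_bigr => k _; rewrite inE; case: eqP.
  by apply/onW_bij/enum_val_bij.
pose p := \row_i (part_size c (enum_val i))%:R : 'rV[algC]_#|V|.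
have -> : y%:M - N *m diag_mx p = diag_mx (\row_i (y - 2 * p 0 i)) + const_mx 1 *m p.
  rewrite mulmxBl mul_scalar_mx; apply/matrixP=> i j; rewrite !mxE big_ord1 !mxE.
  rewrite (bigD1 j) //= big1; last by move=> k nk; rewrite !mxE (negbTE nk) mulr0n mulr0.
  by rewrite !mxE eqxx; case: (i == j); rewrite ?(mulr1n, mulr0n); ring.
rewrite det_diag_add_rank1; last by move=> i; rewrite !mxE subr_eq0.
congr (_ * (1 + _)).
  rewrite [RHS](reindex (fun k : 'I_#|V| => enum_val k)) /=; last exact/onW_bij/enum_val_bij.
  by apply: eq_bigr => i _; rewrite !mxE.
rewrite [RHS](reindex (fun k : 'I_#|V| => enum_val k)) /=; last exact/onW_bij/enum_val_bij.
by apply: eq_bigr => i _; rewrite !mxE.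
Qed.

(** * Rigidity of a polynomial with a positive triple root *)

Lemma deriv_prod_XsubC_horner (F : fieldType) (s : seq F) (a : F) :
  a \notin s -> let P := \prod_(b <- s) ('X - b%:P) in
  P^`().[a] = P.[a] * \sum_(b <- s) (a - b)^-1.
Proof.
elim: s => [|b s IHs] /=; first by rewrite !big_nil -polyC1 derivC !hornerE.
rewrite in_cons negb_or => /andP[ab /IHs/= e].
rewrite !big_cons derivM derivXsubC !hornerE e; field.
by rewrite subr_eq0.
Qed.

(** This is P''/P = (P'/P)^2 + (P'/P)', where P'/P = \sum_b 1/(x - b). *)
Lemma deriv2_prod_XsubC_horner (F : fieldType) (s : seq F) (a : F) :
  a \notin s -> let P := \prod_(b <- s) ('X - b%:P) in
  P^`()^`().[a] = P.[a] * ((\sum_(b <- s) (a - b)^-1) ^+ 2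
                           - \sum_(b <- s) (a - b)^-2).
Proof.
elim: s => [|b s IHs] /=.
  by rewrite !big_nil -polyC1 !derivC !hornerE expr0n subr0.
rewrite in_cons negb_or => /andP[ab sa].
have /= e2 := IHs sa; have /= e1 := deriv_prod_XsubC_horner sa.
rewrite !big_cons derivM derivXsubC mul1r derivD derivM derivXsubC !hornerE e1 e2.
by rewrite /=; field; rewrite subr_eq0.
Qed.

(* Where Q does not vanish, the derivative of x Q'/Q - k at a is
   - \sum_b b / (a - b)^2 < 0. *)
Lemma prod_XsubC_rigid (C : numFieldType) (k : nat) (s t : seq C) (a : C)
    (P := \prod_(b <- s) ('X - b%:P)) (Q := \prod_(b <- t) ('X - b%:P)) :
  0 < a -> (2 < count_mem a s)%N ->
  (forall b, b \in t -> 0 <= b) -> (exists2 b, b \in t & 0 < b) ->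
  'X * P^`() - k%:R *: P = 'X * Q^`() - k%:R *: Q -> P = Q.
Proof.
move=> a0 sa t0 [b bt b0] eT.
have : ('X - a%:P) ^+ 3 %| P.
  rewrite -mup_geq ?mu_prod_XsubC //.
  by rewrite monic_neq0 // monic_prod_XsubC.
case/dvdpP=> R PE.
(* Hence X P' - k P vanishes to second order at [a], and so does X Q' - k Q. *)
have [P0 P1 P2] : [/\ P.[a] = 0, P^`().[a] = 0 & P^`()^`().[a] = 0].
  by rewrite PE !(derivM, derivX, derivXn, derivE, hornerE) /=; split; ring.
have T0 := congr1 (horner^~ a) eT.
have T1 := congr1 (fun p : {poly C} => p^`().[a]) eT.
rewrite /= !(derivE, hornerE) /= P0 P1 in T0.
rewrite /= !(derivE, hornerE) /= P1 P2 in T1.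
have Q0 : Q.[a] = 0.
  apply/eqP/negP=> /negP Qa.
  have ta : a \notin t by rewrite -root_prod_XsubC rootE.
  have := deriv_prod_XsubC_horner ta; have := deriv2_prod_XsubC_horner ta.
  rewrite -/Q /=; set L := \sum_(b <- t) _; set M := \sum_(b <- t) _ => Q2 Q1.
  rewrite Q1 in T0; rewrite Q1 Q2 in T1.
  have aL : a * L = k%:R.
    apply: (mulfI Qa); apply/eqP; rewrite -subr_eq0; apply/eqP.
    transitivity (a * (Q.[a] * L) - k%:R * Q.[a]); first by ring.
    by rewrite -T0; ring.
  (* [L - a * M] is the derivative of x Q'/Q at [a]. *)
  have LM : L - a * M = 0.
    apply: (mulfI Qa); rewrite mulr0.
    transitivity (Q.[a] * L + a * (Q.[a] * (L ^+ 2 - M)) - (a * L) * (Q.[a] * L)); first by ring.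
    by rewrite aL -T1; ring.
  have : 0 < \sum_(b <- t) b * (a - b)^-2.
    have sq c : c \in t -> 0 < (a - c)^-2.
      move=> ct; rewrite invr_gt0 real_exprn_even_gt0 //=.
        by rewrite subr_eq0; apply: contraNneq ta => ->.
      by apply: rpredB; [exact: gtr0_real | exact/ger0_real/t0].
    rewrite (big_rem b bt) /= ltr_pwDl ?mulr_gt0 ?sq // big_seq sumr_ge0 //.
    by move=> c /mem_rem ct; apply: mulr_ge0; [exact: t0 | exact/ltW/sq].
  suff -> : \sum_(b <- t) b * (a - b)^-2 = - (L - a * M) by rewrite LM oppr0 ltxx.
  rewrite opprB mulr_sumr -sumrB big_seq [RHS]big_seq; apply: eq_bigr => c ct.
  by field; rewrite subr_eq0; apply: contraNneq ta => ->.
(* Coefficientwise, X D' = k D reads (j - k) D_j = 0, so [D] is a multiple of X^k; it vanishes at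
   [a > 0], hence is zero. *)
pose D := P - Q.
have DE : D = D`_k *: 'X^k.
  apply/polyP=> j; rewrite coefZ coefXn.
  case: eqVneq => [->|jk]; rewrite ?mulr1 ?mulr0 //.
  have : ('X * D^`() - k%:R *: D)`_j = 0.
    suff -> : 'X * D^`() - k%:R *: D = 0 by rewrite coef0.
    transitivity (('X * P^`() - k%:R *: P) - ('X * Q^`() - k%:R *: Q)).
      by rewrite /D derivB -!mul_polyC; ring.
    by rewrite eT subrr.
  rewrite coefB coefXM coefZ coef_deriv; case: j jk => [|j] jk /=.
    by move/eqP; rewrite sub0r oppr_eq0 mulf_eq0 pnatr_eq0 eq_sym (negbTE jk) => /eqP.
  rewrite -[_ *+ j.+1]mulr_natl -mulrBl => /eqP; rewrite mulf_eq0 subr_eq0 eqr_nat (negbTE jk).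
  by move/eqP.
have : D.[a] = 0 by rewrite !hornerE P0 Q0 subrr.
rewrite DE !hornerE => /eqP; rewrite mulf_eq0 expf_eq0 (gt_eqF a0) andbF orbF => /eqP D0.
by apply/eqP; rewrite -subr_eq0 -/D DE D0 scale0r.
Qed.

(** * The Seidel form on vertex functions *)

Lemma seidel_mx_hermitian (V : finType) (G : sgraph V) :
  seidel_mx G \is hermsymmx.
Proof.
apply/is_hermitianmxP; rewrite expr0 scale1r; apply/matrixP=> i j.
by rewrite !mxE adj_sym (eq_sym j i) !rmorphB rmorphM /= !rmorph_nat rmorph1.
Qed.

Lemma sum_enum_val (R : nmodType) (V : finType) (F : V -> R) :
  \sum_x F x = \sum_(i < #|V|) F (enum_val i).
Proof. by rewrite [LHS](reindex (fun i : 'I_#|V| => enum_val i)) //; apply/onW_bij/enum_val_bij. Qed.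

(** The form belongs to S + I rather than S: the diagonal entries are 1. *)
Definition seidel_form (V : finType) (G : sgraph V) (g : V -> algC) : algC :=
  \sum_x \sum_y g x * (1 - 2 * (adj G x y)%:R) * (g y)^*.

Lemma seidel_count_lt_le1P (V : finType) (G : sgraph V) :
  (count (fun z : algC => z < -1)%R (seidel_spectrum G) <= 1)%N <->
  exists u : V -> algC, forall g : V -> algC,
    \sum_x g x * u x = 0 -> 0 <= seidel_form G g.
Proof.
have formE (w : 'rV[algC]_#|V|) (g : V -> algC) :
    (forall x, g x = w 0 (enum_rank x)) ->
    (w *m (seidel_mx G + 1%:M) *m w^t*) 0 0 = seidel_form G g.
  move=> gE; rewrite mxE /seidel_form [RHS]sum_enum_val.
  under [RHS]eq_bigr => i _ do rewrite sum_enum_val.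
  rewrite [RHS]exchange_big /=; apply: eq_bigr => j _; rewrite !mxE mulr_suml.
  apply: eq_bigr => i _; rewrite !mxE !gE !enum_valK; congr (_ * _ * _).
  by ring.
rewrite /seidel_spectrum; split.
  case/(count_spectrum_lt_le1P (seidel_mx_hermitian G)) => u uP.
  exists (fun x => u (enum_rank x) 0) => g gu.
  rewrite -(formE (\row_i g (enum_val i))); last by move=> x; rewrite mxE enum_rankK.
  apply: uP; apply/matrixP=> i j; rewrite !ord1 mxE [RHS]mxE -[RHS]gu [RHS]sum_enum_val.
  by apply: eq_bigr => k _; rewrite mxE enum_valK.
case=> u uP; apply/(count_spectrum_lt_le1P (seidel_mx_hermitian G)).
exists (\col_i u (enum_val i)) => w wu.
rewrite (formE _ (fun x => w 0 (enum_rank x))) //; apply: uP.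
move/matrixP/(_ 0 0): wu; rewrite !mxE => wu; rewrite -[RHS]wu [LHS]sum_enum_val.
by apply: eq_bigr => k _; rewrite mxE enum_valK.
Qed.

(** Take [u = 1]: on functions with sum zero the J part of S + I vanishes, leaving twice the sum of
    the squared moduli of the sums over the parts. *)
Lemma colored_count_lt_le1 (V I : finType) (G : sgraph V) (c : V -> I) :
  (forall x y, adj G x y = (c x != c y)) ->
  (count (fun z : algC => z < -1)%R (seidel_spectrum G) <= 1)%N.
Proof.
move=> cE; apply/seidel_count_lt_le1P; exists (fun=> 1) => g g0.
have {}g0 : \sum_x g x = 0 by rewrite -[RHS]g0; apply: eq_bigr => x _; rewrite mulr1.
have -> : seidel_form G g = 2 * \sum_i `|\sum_(x | c x == i) g x| ^+ 2
                            - (\sum_x g x) * (\sum_x g x)^*.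
  have -> : \sum_i `|\sum_(x | c x == i) g x| ^+ 2 =
      \sum_x \sum_y g x * (c x == c y)%:R * (g y)^*.
    rewrite [RHS](partition_big c predT) //=; apply: eq_bigr => i _.
    rewrite normCK mulr_suml; apply: eq_bigr => x /eqP ->.
    rewrite rmorph_sum mulr_sumr big_mkcond; apply: eq_bigr => y _.
    by rewrite eq_sym; case: ifP; rewrite ?(mulr1, mulr0, mul0r).
  rewrite rmorph_sum mulr_suml mulr_sumr -sumrB; apply: eq_bigr => x _.
  rewrite !mulr_sumr -sumrB; apply: eq_bigr => y _.
  by rewrite cE; case: eqP => _ /=; ring.
rewrite g0 mul0r subr0 mulr_ge0 // sumr_ge0 // => i _.
by rewrite exprn_ge0.
Qed.

(** Switching conjugates S by the diagonal sign matrix that is -1 on [U]. *)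
Lemma char_poly_seidel_switch (V : finType) (G : sgraph V) (U : {set V}) :
  char_poly (seidel_mx (switch G U)) = char_poly (seidel_mx G).
Proof.
pose s : 'rV[algC]_#|V| := \row_i (-1) ^+ (enum_val i \in U).
have ss : diag_mx s *m diag_mx s = 1%:M.
  rewrite mulmx_diag -diag_const_mx; congr diag_mx; apply/rowP=> i.
  by rewrite !mxE -expr2 sqrr_sign.
rewrite -[RHS](char_poly_conjugate _ ss); congr char_poly.
apply/matrixP=> i j; rewrite mul_mx_diag mxE mul_diag_mx !mxE /= /switch_adj.
case: (eqVneq i j) => [->|_]; first by rewrite eqxx; case: (_ \in U); rewrite /= ?expr0 ?expr1; ring.
by case: (_ \in U); case: (_ \in U); case: adj => /=; rewrite ?expr0 ?expr1; ring.
Qed.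

Lemma sum_deltal (R : pzRingType) (V : finType) (F : V -> R) (x : V) :
  \sum_y (x == y)%:R * F y = F x.
Proof.
rewrite (bigD1 x) //= eqxx mul1r big1 ?addr0 // => y nyx.
by rewrite eq_sym (negbTE nyx) mul0r.
Qed.

(** Evaluates the form at an explicit combination of basis vectors; vertices may repeat in [s], so
    no distinctness has to be checked. *)
Lemma seidel_form_seq (V : finType) (G : sgraph V) (s : seq (algC * V)) :
  seidel_form G (fun x => \sum_(p <- s) p.1 * (p.2 == x)%:R) =
  \sum_(p <- s) \sum_(q <- s) p.1 * (1 - 2 * (adj G p.2 q.2)%:R) * (q.1)^*.
Proof.
rewrite /seidel_form.
transitivity (\sum_x \sum_(p <- s) (p.2 == x)%:R *
    \sum_(q <- s) p.1 * (1 - 2 * (adj G x q.2)%:R) * (q.1)^*).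
  apply: eq_bigr => x _.
  transitivity (\sum_(p <- s) \sum_y p.1 * (p.2 == x)%:R * (1 - 2 * (adj G x y)%:R)
      * (\sum_(q <- s) q.1 * (q.2 == y)%:R)^*).
    by rewrite exchange_big; apply: eq_bigr => y _; rewrite !mulr_suml.
  apply: eq_bigr => p _; rewrite mulr_sumr.
  under eq_bigr => y _ do rewrite rmorph_sum mulr_sumr.
  rewrite exchange_big; apply: eq_bigr => q _.
  rewrite -[in RHS](sum_deltal
    (fun y => p.1 * (1 - 2 * (adj G x y)%:R) * (q.1)^*)) mulr_sumr.
  by apply: eq_bigr => y _; rewrite rmorphM /= rmorph_nat; ring.
by rewrite exchange_big; apply: eq_bigr => p _; rewrite sum_deltal.
Qed.

(* If zw were an edge, the form of S + I would be negative definite on the plane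
   spanned by e_x + e_y - 2 e_v and e_w + 2 e_z - 3 e_v. *)
Lemma no_edge_avoiding_vertex (V : finType) (G : sgraph V) (v x y z w : V) :
  (count (fun z : algC => z < -1)%R (seidel_spectrum G) <= 1)%N ->
  (forall t, adj G v t = false) ->
  adj G x y -> ~~ adj G z x -> ~~ adj G z y -> ~~ adj G z w.
Proof.
case/seidel_count_lt_le1P=> u uP v0 xy /negbTE zx /negbTE zy; apply/negP=> zw.
pose U1 := u x + u y - 2 * u v; pose U2 := u w + 2 * u z - 3 * u v.
have [a [b [ab0 nz]]] : exists a, exists b, a * U1 + b * U2 = 0 /\ (a != 0) || (b != 0).
  have [a0|a0] := eqVneq U1 0; first by exists 1, 0; rewrite a0 mulr0 mul0r addr0 oner_eq0.
  by exists (- U2), U1; rewrite mulNr mulrC addNr a0 orbT.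
(* The vector a (e_x + e_y - 2 e_v) + b (e_w + 2 e_z - 3 e_v), with [a], [b] chosen so that [u]
   annihilates it. *)
pose s := [:: (a, x); (a, y); (b, w); (2 * b, z); (- 2 * a - 3 * b, v)].
have : 0 <= seidel_form G (fun x => \sum_(p <- s) p.1 * (p.2 == x)%:R).
  apply: uP; under eq_bigr => t _ do rewrite mulr_suml.
  rewrite exchange_big /=.
  have delta (c : algC) (t : V) : \sum_r c * (t == r)%:R * u r = c * u t.
    by under eq_bigr => r _ do rewrite -mulrA; rewrite -mulr_sumr sum_deltal.
  by rewrite /s !big_cons big_nil /= !delta -[RHS]ab0 /U1 /U2; ring.
rewrite seidel_form_seq /s !big_cons !big_nil /=.
have sv t : adj G t v = false by rewrite adj_sym.
rewrite !v0 !sv !adj_irrefl !(adj_sym G _ z) !zx !zy !zw !(adj_sym G y x) !xy.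
rewrite !(adj_sym G x w) !(adj_sym G y w).
rewrite !(rmorphB, rmorphD, rmorphM, rmorphN, rmorph_nat) /=.
set e1 := adj G w x; set e2 := adj G w y.
(* The form takes the value -2 E; only the adjacencies of [w] to [x] and [y] are left
   undetermined. *)
pose E := 2 * (a * a^*) + 4 * (b * b^*) + (e1%:R + e2%:R) * (a * b^* + b * a^*).
have Epos : 0 < E.
  have [b0|b0] := eqVneq b 0.
    rewrite b0 eqxx orbF in nz.
    by rewrite /E b0 rmorph0 !(mulr0, mul0r, addr0) mulr_gt0 // mul_conjC_gt0.
  (* With t = e1 + e2 <= 2, E = (4 - t)|b|^2 + (2 - t)|a|^2 + t|a + b|^2. *)
  have -> : E = (4 - e1%:R - e2%:R) * (b * b^*) + ((2 - e1%:R - e2%:R) * (a * a^*)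
      + (e1%:R + e2%:R) * ((a + b) * (a + b)^*)) by rewrite /E rmorphD /=; ring.
  rewrite ltr_pwDl //.
    rewrite mulr_gt0 ?mul_conjC_gt0 // -addrA -opprD -natrD subr_gt0 ltr_nat.
    by rewrite /e1 /e2; do 2!case: (adj G w _).
  apply: addr_ge0; apply: mulr_ge0; rewrite ?mul_conjC_ge0 // -?natrD ?ler0n //.
  rewrite -addrA -opprD -natrD subr_ge0 ler_nat.
  by rewrite /e1 /e2; do 2!case: (adj G w _).
move=> ge0; have : 0 <= - 2 * E by move: ge0; congr (0 <= _); rewrite /E; ring.
by rewrite mulNr oppr_ge0 pmulr_rle0 // lt_geF.
Qed.

(** * Switching to a complete multipartite graph *)

Lemma switch_switch (V : finType) (G : sgraph V) (U1 U2 : {set V}) :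
  adj (switch (switch G U1) U2) =2
  adj (switch G ((U1 :\: U2) :|: (U2 :\: U1))).
Proof.
move=> x y; rewrite /= /switch_adj /= /switch_adj !inE.
by case: (x \in U1); case: (x \in U2); case: (y \in U1); case: (y \in U2); rewrite /= ?negbK.
Qed.

Lemma colorable_of_nonadj_trans (V : finType) (G : sgraph V) :
  (forall y x z, ~~ adj G x y -> ~~ adj G y z -> ~~ adj G x z) ->
  exists c : V -> V, forall x y, adj G x y = (c x != c y).
Proof.
(* Non-adjacency is an equivalence relation, and [pick] chooses the same representative from equal
   classes. The default [x] never arises, since [x] lies in its own class. *)
move=> tr; pose c x := odflt x [pick y | ~~ adj G x y].
have cP x : ~~ adj G x (c x).
  by rewrite /c; case: pickP => [//|/(_ x)]; rewrite adj_irrefl.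
exists c => x y; apply/idP/idP => [|]; apply: contraTT.
  rewrite negbK => /eqP cxy; apply: (tr (c x)) => //.
  by rewrite cxy adj_sym.
move=> xy; rewrite negbK /c.
have -> : [pick z | ~~ adj G x z] = [pick z | ~~ adj G y z].
  apply: eq_pick => z; apply/idP/idP; apply: tr => //.
  by rewrite adj_sym.
by case: pickP => [//|/(_ y)]; rewrite adj_irrefl.
Qed.

Lemma perm_spectrum_char_poly m n (A : 'M[algC]_m) (B : 'M[algC]_n) :
  perm_eq (spectrum A) (spectrum B) <-> char_poly A = char_poly B.
Proof.
rewrite !char_poly_spectrum; split; first by move/(perm_big _) => ->.
exact: prod_XsubC_eq.
Qed.

Lemma switching_to_multipartite (V : finType) (G : sgraph V) :
  (count (fun z : algC => z < -1)%R (seidel_spectrum G) <= 1)%N ->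
  exists U : {set V}, exists c : V -> V,
    forall x y, adj (switch G U) x y = (c x != c y).
Proof.
move=> le1; case: (pickP (@predT V)) => [v _|V0]; last first.
  by exists set0, id => x; have := V0 x.
(* Switching the neighbourhood of [v] isolates [v]. *)
pose U1 := [set x | adj G v x]; pose G1 := switch G U1.
have le1' : (count (fun z : algC => z < -1)%R (seidel_spectrum G1) <= 1)%N.
  suff /permP -> : perm_eq (seidel_spectrum G1) (seidel_spectrum G) by [].
  by apply/perm_spectrum_char_poly/char_poly_seidel_switch.
have v0 x : adj G1 v x = false.
  rewrite /= /switch_adj !inE adj_irrefl; case: (adj G v x) => //.
have := @switch_switch _ G U1; rewrite -/G1.
move: G1 le1' v0 => G1 le1' v0 sw.
pose U2 := [set x | [forall y, ~~ adj G1 x y]].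
exists ((U1 :\: U2) :|: (U2 :\: U1)).
suff [c cE] : exists c : V -> V, forall x y, adj (switch G1 U2) x y = (c x != c y).
  by exists c => x y; rewrite -sw cE.
apply: colorable_of_nonadj_trans => y x z /=; rewrite /switch_adj.
have iso t r : t \in U2 -> ~~ adj G1 t r by rewrite inE => /forallP/(_ r).
(* After the second switching a vertex of [U2] is adjacent exactly to the vertices outside [U2], so
   [U2] forms a single part. *)
have [xU|xU] := boolP (x \in U2); have [yU|yU] := boolP (y \in U2);
  have [zU|zU] := boolP (z \in U2); rewrite /= ?negbK //.
- by move=> _ _; apply: iso.
- by rewrite (negbTE (iso y _ yU)).
- by rewrite (negbTE (iso x _ xU)).
- by rewrite (negbTE (iso x _ xU)).
- by rewrite adj_sym (negbTE (iso y _ yU)).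
- by rewrite adj_sym (negbTE (iso y _ yU)).
- by rewrite [adj G1 y z]adj_sym (negbTE (iso z _ zU)).
(* Outside [U2]: if [x], [z] were adjacent, [y] would avoid the edge xz and so have no neighbour,
   contradicting [yU]. *)
move=> xy yz; apply/negP => xz.
move: yU; rewrite inE; case/forallP => w.
by apply: (no_edge_avoiding_vertex w le1' v0 xz) => //; rewrite adj_sym.
Qed.

(** * From equal characteristic polynomials to an isomorphism *)

Lemma fiber_bijection (V W : finType) (T : eqType) (a : V -> T) (b : W -> T) :
  #|V| = #|W| ->
  (forall t, #|[set x | a x == t]| = #|[set y | b y == t]|) ->
  exists2 f : V -> W, bijective f & forall x, b (f x) = a x.
Proof.
move=> VW ab; pose A t := enum [set x | a x == t]; pose B t := enum [set y | b y == t].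
have AB t : size (A t) = size (B t) by rewrite -!cardE.
(* [f] sends the k-th element of a fibre of [a] to the k-th element of the fibre of [b] over the
   same value. *)
have /fin_all_exists[f fP] : forall x, exists y,
    y \in B (a x) /\ index y (B (a x)) = index x (A (a x)).
  move=> x; have xA : x \in A (a x) by rewrite mem_enum inE.
  move: (xA); rewrite -index_mem AB => lt.
  case: (B (a x)) (enum_uniq [set y | b y == a x] : uniq (B (a x))) lt => // y0 s us lt.
  by exists (nth y0 (y0 :: s) (index x (A (a x)))); rewrite mem_nth ?index_uniq.
have bf x : b (f x) = a x.
  by case: (fP x); rewrite mem_enum inE => /eqP.
exists f => //; apply: inj_card_bij; last by rewrite VW.
move=> x y fxy; have axy : a x = a y by rewrite -!bf fxy.
have [_] := fP x; have [_] := fP y; rewrite fxy axy => -> e.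
have xA : x \in A (a y) by rewrite mem_enum inE axy.
have yA : y \in A (a y) by rewrite mem_enum inE.
by rewrite -(nth_index x yA) e nth_index.
Qed.

(** Extends to polynomials an identity checked only at large integers, where no denominator
    vanishes. *)
Lemma poly_eq0_natr (C : numFieldType) (p : {poly C}) (N : nat) :
  (forall m, (N < m)%N -> p.[m%:R] = 0) -> p = 0.
Proof.
move=> pN; apply/eqP/negP=> /negP p0.
pose rs := [seq m%:R : C | m <- iota N.+1 (size p)].
have := @max_poly_roots _ p rs p0; rewrite size_map size_iota ltnn.
suff -> : all (root p) rs; first suff -> : uniq rs by move/(_ isT isT).
  by rewrite map_inj_uniq ?iota_uniq // => m n /eqP; rewrite eqr_nat => /eqP.
apply/allP=> _ /mapP[m + ->]; rewrite mem_iota => /andP[Nm _].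
by rewrite rootE pN.
Qed.

Definition doubled_part_sizes (V : finType) (c : V -> V) : seq algC :=
  [seq 2 * (part_size c i)%:R | i <- enum V].

(** Summing 2p/(m - 2p) = m/(m - 2p) - 1 over the colours turns the determinant formula into P'/P.
    The bound on [m] exceeds every root of [P]. *)
Lemma seidel_char_poly_horner (V : finType) (G : sgraph V) (c : V -> V) (m : nat)
    (P := \prod_(b <- doubled_part_sizes c) ('X - b%:P)) :
  (forall x y, adj G x y = (c x != c y)) -> (2 * #|V| < m)%N ->
  2 * (char_poly (seidel_mx G)).[m%:R - 1] =
    m%:R * P^`().[m%:R] - (#|V|%:R - 2) * P.[m%:R].
Proof.
move=> cE Vm.
have ltm i : (2 * part_size c i < m)%N.
  by apply: leq_ltn_trans Vm; rewrite leq_mul2l max_card orbT.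
have mp i : m%:R - 2 * (part_size c i)%:R != 0 :> algC.
  by rewrite subr_eq0 -natrM eqr_nat gtn_eqF.
rewrite (seidel_char_poly_colored cE); first last.
- by move=> i; rewrite -subr_eq0.
- by rewrite pnatr_eq0 -lt0n (leq_ltn_trans _ Vm).
rewrite deriv_prod_XsubC_horner; last first.
  by apply/mapP=> -[i _ e]; have := mp i; rewrite e subrr eqxx.
have -> : P.[m%:R] = \prod_i (m%:R - 2 * (part_size c i)%:R).
  by rewrite /P big_map horner_prod big_enum; apply: eq_bigr => i _; rewrite !hornerE.
rewrite big_map big_enum /=.
have -> : #|V|%:R = \sum_(i : V) 1 :> algC by rewrite sumr_const.
set Pi := \prod_i _; rewrite mulrCA [m%:R * _]mulrCA [_ * Pi]mulrC -mulrBr; congr (_ * _).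
rewrite mulrDr mulr1 opprB addrA [in RHS]addrAC addrC; congr (_ + _).
rewrite !mulr_sumr -sumrB; apply: eq_bigr => i _.
by field; rewrite mp.
Qed.

Lemma colored_seidel_rigid (V W : finType) (G : sgraph V) (H : sgraph W)
    (c : V -> V) (d : W -> W) (m : nat) :
  (forall x y, adj G x y = (c x != c y)) ->
  (forall x y, adj H x y = (d x != d y)) ->
  (0 < m)%N -> (2 < #|[set i | part_size c i == m]|)%N ->
  char_poly (seidel_mx H) = char_poly (seidel_mx G) -> isomorphic H G.
Proof.
move=> cE dE m0 cm eHG.
have WV : #|W| = #|V|.
  by apply: succn_inj; rewrite -(size_char_poly (seidel_mx H)) eHG size_char_poly.
have V2 : (2 < #|V|)%N by apply: leq_trans cm (max_card _).
pose P := \prod_(b <- doubled_part_sizes c) ('X - b%:P).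
pose Q := \prod_(b <- doubled_part_sizes d) ('X - b%:P).
have count_sizes (U : finType) (e : U -> U) n :
    count_mem (2 * n%:R) (doubled_part_sizes e) = #|[set i | part_size e i == n]|.
  rewrite count_map cardE enumT /enum_mem size_filter; apply: eq_count => i /=.
  by rewrite inE -!natrM eqr_nat eqn_mul2l.
have PQ : P = Q.
  (* The truncated subtraction is exact because [V2] gives more than two vertices. *)
  apply: (@prod_XsubC_rigid _ (#|V| - 2) _ _ (2 * m%:R)).
  - by rewrite -natrM ltr0n muln_gt0.
  - by rewrite count_sizes.
  - by move=> b /mapP[i _ ->]; rewrite -natrM ler0n.
  - have /card_gt0P[y _] : (0 < #|W|)%N by rewrite WV (ltn_trans _ V2).
    exists (2 * (part_size d (d y))%:R); first by apply: map_f; rewrite mem_enum.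
    by rewrite -natrM ltr0n muln_gt0 /=; apply/card_gt0P; exists y; rewrite inE.
  apply/eqP; rewrite -subr_eq0; apply/eqP.
  apply: (@poly_eq0_natr _ _ (2 * #|V|)) => k Vk.
  have eG := seidel_char_poly_horner cE Vk.
  rewrite -WV in Vk; have eH := seidel_char_poly_horner dE Vk.
  rewrite eHG eG WV -/P -/Q in eH.
  by rewrite !hornerE natrB ?(ltnW V2) // eH subrr.
have /permP pPQ := prod_XsubC_eq PQ.
(* First match colours with equal part sizes, empty ones included; then match the vertices inside
   corresponding parts. *)
have [s [s' sK s'K] sP] : exists2 s : W -> V, bijective s &
    forall j, part_size c (s j) = part_size d j.
  apply: fiber_bijection => // n.
  by rewrite -!count_sizes pPQ.
have [f fbij fP] : exists2 f : W -> V, bijective f & forall x, c (f x) = s (d x).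
  apply: fiber_bijection => // i; rewrite -/(part_size c i) -(s'K i) sP.
  by apply: eq_card => x; rewrite !inE (can_eq sK).
by exists f => // x y; rewrite cE !fP (can_eq sK) dE.
Qed.

Local Close Scope sesquilinear_scope.
Local Close Scope ring_scope.

(** * Multipartite graphs whose part sizes each occur at least three times *)

Theorem theorem3p7 (l : nat) (p s : 'I_l -> nat)
    (hl : 1 <= l)
    (p_decr : forall i j : 'I_l, i < j -> p j < p i)
    (p_pos : forall i : 'I_l, 1 <= p i)
    (s_ge3 : forall i : 'I_l, 3 <= s i) :
  S_determined (complete_multipartite_rep p s).
Proof.
set G := complete_multipartite_rep p s.
pose V : finType := {k : {i : 'I_l & 'I_(s i)} & 'I_(p (tag k))}.
move=> W H spHG.
have eHG : char_poly (seidel_mx H) = char_poly (seidel_mx G).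
  exact/perm_spectrum_char_poly.
have leH : count (fun z : algC => z < -1)%R (seidel_spectrum H) <= 1.
  by rewrite (permP spHG); apply: (@colored_count_lt_le1 _ _ G (fun x => tag x)).
have [U [d dE]] := switching_to_multipartite leH.
exists (switch H U); first by exists U.
have [c cE] : exists c : V -> V, forall x y, adj G x y = (c x != c y).
  apply: colorable_of_nonadj_trans => y x z; rewrite /= /multipartite_adj !negbK.
  by move=> /eqP-> /eqP->.
have cT x y : (c x == c y) = (tag x == tag y).
  by have := cE x y; rewrite /= /multipartite_adj; do 2!case: eqP.
pose i0 := Ordinal hl.
(* The first vertices of three parts of size [p i0]; their colours make [2 * p i0] a root of
   multiplicity at least three. *)
pose x (k : 'I_3) : V :=
  Tagged (fun k : {i : 'I_l & 'I_(s i)} => 'I_(p (tag k)))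
    (Ordinal (p_pos i0) : 'I_(p (tag (Tagged (fun i => 'I_(s i)) (widen_ord (s_ge3 i0) k))))).
have xsize k : part_size c (c (x k)) = p i0.
  rewrite /part_size -[RHS]card_ord.
  pose h (j : 'I_(p i0)) : V :=
    Tagged (fun k : {i : 'I_l & 'I_(s i)} => 'I_(p (tag k)))
      (j : 'I_(p (tag (Tagged (fun i => 'I_(s i)) (widen_ord (s_ge3 i0) k))))).
  have hinj : injective h.
    by move=> j j' /eqP; rewrite -tag_eqE /tag_eq eqxx /= tagged_asE => /eqP.
  rewrite -(card_imset _ hinj); apply: eq_card => y; rewrite inE cT.
  apply/eqP/imsetP => [|[j _ ->]] //=.
  by case: y => t j /= tE; rewrite tE in j *; exists j.
have cx_inj : injective (fun k => c (x k)).
  move=> k k' /eqP; rewrite cT /= -tag_eqE /tag_eq eqxx /= tagged_asE => /eqP.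
  by move/(congr1 val) => /= e; apply: val_inj.
apply: (colored_seidel_rigid cE dE (p_pos i0)); last by rewrite char_poly_seidel_switch.
apply: (@leq_trans #|[set c (x k) | k : 'I_3]|); first by rewrite card_imset ?card_ord.
by apply/subset_leq_card/subsetP => _ /imsetP[k _ ->]; rewrite inE xsize.
Qed.
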